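(* Let $\sigma,\rho\ge0$ and $\nu>0$. The capacity $C$ of an AWGN channel with a $(\sigma,\rho)$-power constraint and noise power $\nu$ satisfies $$C\le \lim_{\epsilon\to0_+}\ \limsup_{n\to\infty}\ \frac1n\log \mathrm{Vol}\left(\mathcal S_n(\sigma,\rho)\oplus B_n\left(\sqrt{n(\nu+\epsilon)}\right)\right)-\frac12\log 2\pi e\nu .$$
   Context: All logarithms are natural and rates are in nats. $\mathcal S_n(\sigma,\rho)=\{x^n\in\mathbb R^n:\ \sum_{j=k+1}^{l}x_j^2\le \sigma+(l-k)\rho\ \text{ for all } 0\le k<l\le n\}$. $B_n(r)$ is the closed Euclidean ball of radius $r$ in $\mathbb R^n$ centered at the origin, $K\oplus L=\{x+z: x\in K, z\in L\}$ is the Minkowski sum, and $\mathrm{Vol}$ is $n$-dimensional Lebesgue measure. AWGN channel with noise power $\nu$: input $X_i$, output $Y_i=X_i+Z_i$, where $Z_1,Z_2,\dots$ are i.i.d. $\mathcal N(0,\nu)$ independent of the input. A code of block length $n$ and rate $R$ for the $(\sigma,\rho)$-power constraint consists of a message set $\{1,\dots,\lfloor e^{nR}\rfloor\}$, an encoder mapping messages into $\mathcal S_n(\sigma,\rho)$, and a decoder mapping $\mathbb R^n$ to messages. A rate $R$ is achievable if there is a sequence of such codes ($n\to\infty$) whose probability of decoding error (for a uniformly distributed message) tends to $0$. The capacity $C$ is the supremum of achievable rates. *)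

(* Defs.v *)
From HB Require Import structures.
From mathcomp Require Import all_boot all_order all_algebra archimedean finmap.
From mathcomp Require Import all_classical all_reals all_analysis.

Set Implicit Arguments.
Unset Strict Implicit.
Unset Printing Implicit Defensive.

Import Order.TTheory GRing.Theory Num.Theory.
Import numFieldNormedType.Exports.

Local Open Scope classical_set_scope.
Local Open Scope ring_scope.

(* R^n is n.-tuple R, which carries the product sigma-algebra of the library;
   coordinates are numbered from 0. *)
Section euclidean_space.
Context {R : realType}.

Definition tuple_add n (x z : n.-tuple R) : n.-tuple R :=
  [tuple tnth x i + tnth z i | i < n].

Definition minkowski_sum n (K L : set (n.-tuple R)) : set (n.-tuple R) :=
  [set tuple_add x z | x in K & z in L].

Definition euclidean_norm n (x : n.-tuple R) : R :=
  Num.sqrt (\sum_(i < n) tnth x i ^+ 2).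

Definition euclidean_ball n (r : R) : set (n.-tuple R) :=
  [set x | euclidean_norm x <= r].
Arguments euclidean_ball : clear implicits.

(* n-dimensional Lebesgue measure, by R^0 = {point} and R^(n+1) = R * R^n. *)
Fixpoint volume n : set (n.-tuple R) -> \bar R :=
  match n with
  | 0 => dirac [tuple]
  | m.+1 => pushforward (lebesgue_measure \x @volume m)%E
              (fun p : R * m.-tuple R => [tuple of p.1 :: p.2])
  end.

(* With coordinates numbered from 0, the entries x_(k+1), ..., x_l are the
   coordinates j with k <= j < l. *)
Definition power_constraint n (sigma rho : R) : set (n.-tuple R) :=
  [set x | forall k l : nat, (k < l <= n)%N ->
     \sum_(j < n | (k <= j < l)%N) tnth x j ^+ 2 <= sigma + (l - k)%:R * rho].
Arguments power_constraint : clear implicits.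

(* lne 0 = -oo, lne +oo = +oo. *)
Definition volume_exponent (sigma rho nu eps : R) : \bar R :=
  limn_esup (fun n => (n%:R^-1)%:E *
    lne (volume (minkowski_sum (power_constraint n sigma rho)
                   (euclidean_ball n (Num.sqrt (n%:R * (nu + eps))%R)))))%E.

End euclidean_space.

Arguments euclidean_ball {R} n r _.
Arguments power_constraint {R} n sigma rho _.

Section awgn.
Context {d : measure_display} {Omega : measurableType d} {R : realType}
  {P : probability Omega R}.

Definition mutually_independent (X : nat -> {RV P >-> R}) :=
  forall (J : {fset nat}) (A : nat -> set R),
    (forall j, measurable (A j)) ->
    P (\bigcap_(j in [set` J]) (X j @^-1` A j)) =
    (\prod_(j <- J) P (X j @^-1` A j))%E.

(* The second parameter of normal_prob is the standard deviation. *)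
Definition awgn_noise (nu : R) (Z : nat -> {RV P >-> R}) :=
  mutually_independent Z /\
  forall i (A : set R), measurable A ->
    distribution P (Z i) A = normal_prob 0 (Num.sqrt nu) A.

Definition noise_vector (Z : nat -> {RV P >-> R}) n (w : Omega) : n.-tuple R :=
  [tuple Z i w | i < n].

(* Messages are numbered 0, ..., M - 1. The decoding regions have to be
   measurable for the probability of error to be defined. *)
Record code (sigma rho : R) (n M : nat) := Code {
  encoder : 'I_M -> n.-tuple R;
  decoder : n.-tuple R -> 'I_M;
  encoder_power : forall m, power_constraint n sigma rho (encoder m);
  decoder_measurable : forall m, measurable (decoder @^-1` [set m]) }.

Definition error_event (Z : nat -> {RV P >-> R}) (sigma rho : R) (n M : nat)
    (c : code sigma rho n M) (m : 'I_M) : set Omega :=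
  [set w | decoder c (tuple_add (encoder c m) (noise_vector Z n w)) <> m].

(* The message is uniform and independent of the noise, so the probability of
   error is the average over the messages. *)
Definition error_probability (Z : nat -> {RV P >-> R}) (sigma rho : R)
    (n M : nat) (c : code sigma rho n M) : \bar R :=
  ((M%:R^-1)%:E * \sum_(m < M) P (error_event Z c m))%E.

Definition achievable (Z : nat -> {RV P >-> R}) (sigma rho rate : R) :=
  exists c : forall n, code sigma rho n (Num.truncn (expR (n%:R * rate))),
    error_probability Z (c n) @[n --> \oo] --> 0%E.

Definition capacity (Z : nat -> {RV P >-> R}) (sigma rho : R) : \bar R :=
  ereal_sup [set rate%:E | rate in achievable Z sigma rho].

End awgn.

(* Main.v *)
(* The noise vector of length n has squared norm within n delta of n nu except
   with exponentially small probability, and on this shell its density is at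
   most (2 pi e nu)^(-n/2) e^(n delta / (2 nu)). Hence the part of the shifted
   shell around a codeword that is decoded correctly has volume at least
   (2 pi e nu)^(n/2) e^(-n delta / (2 nu)) times the probability of a correct
   decision with typical noise. These parts are disjoint and lie in the
   Minkowski sum of the constraint set and the ball of radius
   sqrt(n (nu + delta)), so about e^(nR) such volumes fit into it. *)
From HB Require Import structures.
Require Import Defs.
From mathcomp Require Import all_boot all_order all_algebra finmap.
From mathcomp Require Import all_classical all_reals all_analysis.
From mathcomp Require Import measurable_realfun.
From mathcomp Require Import ring lra.

Set Implicit Arguments.
Unset Strict Implicit.
Unset Printing Implicit Defensive.

Import Order.TTheory GRing.Theory Num.Theory.
Import numFieldNormedType.Exports.

Local Open Scope classical_set_scope.
Local Open Scope ring_scope.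

(** * Iterated products of a measure on the line *)

Section iterated_product.
Context {R : realType}.

Definition tuple_cons n (a : R) (t : n.-tuple R) : n.+1.-tuple R :=
  [tuple of a :: t].

Section definition.
Variable m : set (measurableTypeR R) -> \bar R.

(** The recursion of [volume] with the one-dimensional measure as a parameter. Lebesgue measure
    gives [volume] by conversion and a normal law gives the law of the noise vector, so one
    induction on [n] can compare the two. *)
Fixpoint iterated_product n : set (n.-tuple R) -> \bar R :=
  match n with
  | 0 => dirac [tuple]
  | k.+1 => pushforward (m \x @iterated_product k)%E
              (fun p : R * k.-tuple R => [tuple of p.1 :: p.2])
  end.

Lemma iterated_productS n (A : set (n.+1.-tuple R)) :
  iterated_product A =
  (\int[m]_a iterated_product [set t | A (tuple_cons a t)])%E.
Proof.
rewrite /= /pushforward /product_measure1; congr (integral _ _ _).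
apply/funext => a /=; congr iterated_product.
by apply/seteqP; split => t; rewrite /xsection/= inE.
Qed.

End definition.

Lemma volumeE n : @volume R n = iterated_product lebesgue_measure (n:=n).
Proof. by []. Qed.

Lemma measurable_cons_pair n :
  measurable_fun [set: measurableTypeR R * n.-tuple R]
    (fun p => tuple_cons p.1 p.2).
Proof.
apply: (@measurable_cons _ _ (measurableTypeR R * n.-tuple R)%type R fst n snd).
  exact: measurable_fst.
exact: measurable_snd.
Qed.

Lemma measurable_uncons n : measurable_fun [set: n.+1.-tuple R]
  (fun t => (thead t, [tuple of behead t]) : measurableTypeR R * n.-tuple R).
Proof.
apply: (@measurable_fun_pair _ _ _ (n.+1.-tuple R) (measurableTypeR R)
  (n.-tuple R)).
  exact: (@measurable_tnth _ R n.+1 ord0).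
exact: measurable_behead.
Qed.

(* An equality of set functions, so it also covers non-measurable sets. *)
Lemma iterated_product_measure
    (m : {sigma_finite_measure set (measurableTypeR R) -> \bar R}) n :
  exists mu : {sigma_finite_measure set (n.-tuple R) -> \bar R},
    iterated_product m (n:=n) = mu.
Proof.
elim: n => [|n [mu muE]].
  by exists (dirac [tuple]).
pose phi := fun p : measurableTypeR R * n.-tuple R => tuple_cons p.1 p.2.
have mphi : measurable_fun setT phi by exact: measurable_cons_pair.
pose pm : {measure set (measurableTypeR R * n.-tuple R)%type -> \bar R} :=
  (m \x mu)%E.
pose nuM : {measure set (n.+1.-tuple R) -> \bar R} :=
  measure_function_pushforward__canonical__measure_function_Measure pm mphi.
have sf : sigma_finite setT nuM.
  have /sigma_finiteP[F [FT ndF Foo]] := sigma_finiteT m.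
  have /sigma_finiteP[G [GT ndG Goo]] := sigma_finiteT mu.
  pose g (t : n.+1.-tuple R) := (thead t, [tuple of behead t]).
  have gphi : g \o phi = id.
    by apply/funext => -[a t] /=; congr pair => //; apply/val_inj.
  (* The exhaustion is by boxes, pulled back along the inverse [g] of [phi]. As [F] and [G]
     increase, the box of index [maxn i j] contains a point whose head lies in [F i] and whose tail
     lies in [G j]. *)
  exists (fun k => g @^-1` (F k `*` G k)).
    rewrite -preimage_bigcup; apply/seteqP; split => // t _.
    have [i _ Fi] : (\bigcup_k F k) (thead t) by rewrite -FT.
    have [j _ Gj] : (\bigcup_k G k) [tuple of behead t] by rewrite -GT.
    exists (maxn i j) => //; split => /=.
      by move: Fi; exact/subsetPset/ndF/leq_maxl.
    by move: Gj; exact/subsetPset/ndG/leq_maxr.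
  move=> k; have [mF Fk] := Foo k; have [mG Gk] := Goo k; split.
    rewrite -[X in measurable X]setTI; apply: measurable_uncons => //.
    exact: measurableX.
  rewrite /= /pushforward -[_ @^-1` _]/((g \o phi) @^-1` _) gphi preimage_id.
  by rewrite product_measure1E// lte_mul_pinfty// ge0_fin_numE.
pose H := Measure_isSigmaFinite.Build _ _ _ nuM sf.
pose nuS : {sigma_finite_measure set (n.+1.-tuple R) -> \bar R} :=
   HB.pack (nuM : set _ -> \bar R) nuM H.
by exists nuS; rewrite /= muE.
Qed.

End iterated_product.

(** * Integration against a measure with a density *)

Section density.
Local Open Scope ereal_scope.

(* No measurability is assumed: the Minkowski sum is not shown measurable. *)
Lemma nnintegral_le d (T : measurableType d) (R : realType)
    (mu : {measure set T -> \bar R}) (f g : T -> \bar R) :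
  (forall x, 0 <= f x) -> (forall x, f x <= g x) ->
  \int[mu]_x f x <= \int[mu]_x g x.
Proof.
move=> f0 fg; rewrite !ge0_integralTE//; last first.
  by move=> x; exact: le_trans (fg x).
apply: le_ereal_sup => _ [h hf <-]; exists h => // x.
exact: le_trans (fg x).
Qed.

Import HBNNSimple.

(** By monotone convergence both sides are limits along the increasing simple approximations [h_] of
    [h]; for a simple function the identity is the hypothesis [nuE] applied to its level sets. *)
Lemma ge0_integral_density d (T : measurableType d) (R : realType)
    (mu nu : {measure set T -> \bar R}) (f : T -> R) :
  measurable_fun setT f -> (forall x, 0 <= f x)%R ->
  (forall A, measurable A -> nu A = \int[mu]_(x in A) (f x)%:E) ->
  forall h : T -> \bar R, measurable_fun setT h -> (forall x, 0 <= h x) ->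
  \int[nu]_x h x = \int[mu]_x ((f x)%:E * h x).
Proof.
move=> mf f0 nuE h mh h0.
pose h_ := nnsfun_approx measurableT mh.
have h_cvg x : (h_ n x)%:E @[n --> \oo] --> h x.
  by apply: cvg_nnsfun_approx => // y _; exact: h0.
have h_nd x : {homo (fun n => (h_ n x)%:E) : m n / (m <= n)%N >-> m <= n}.
  by move=> m n mn; rewrite lee_fin; exact/lefP/nd_nnsfun_approx.
transitivity (limn (fun n => \int[nu]_x (h_ n x)%:E)).
  rewrite -monotone_convergence//.
  - by apply: eq_integral => y _; apply/esym/cvg_lim => //; exact: h_cvg.
  - by move=> n; exact/measurable_EFinP/measurable_funP.
  - by move=> n y _; rewrite lee_fin.
rewrite [X in limn X](_ : _ =
    (fun n => \int[mu]_x ((f x)%:E * (h_ n x)%:E))).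
  rewrite -monotone_convergence//.
  - apply: eq_integral => y _; apply/cvg_lim => //.
    by apply: cvgeZl => //; exact: h_cvg.
  - move=> n; apply: emeasurable_funM; apply/measurable_EFinP => //.
  - by move=> n y _; rewrite mule_ge0 ?lee_fin.
  - move=> y _ m n mn; rewrite lee_pmul ?lee_fin//.
    exact/lefP/nd_nnsfun_approx.
apply/funext => n.
rewrite integralT_nnsfun sintegralE.
transitivity (\int[mu]_x (\sum_(y \in range (h_ n))
    y%:E * ((f x)%:E * (\1_(h_ n @^-1` [set y]) x)%:E))); last first.
  apply: eq_integral => x _; rewrite fimfunE -fsumEFin// ge0_mule_fsumr.
    by apply: eq_fsbigr => y _; rewrite muleCA EFinM.
  by move=> y; rewrite EFinM nnfun_muleindic_ge0.
rewrite ge0_integral_fsum//.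
- apply: eq_fsbigr => y; rewrite inE => -[z _ yE].
  rewrite ge0_integralZl//.
  + congr (_ * _); rewrite nuE// integral_mkcond; apply: eq_integral => x _.
    by rewrite epatch_indic.
  + by apply: emeasurable_funM; apply/measurable_EFinP.
  + by move=> x _; rewrite mule_ge0 ?lee_fin.
  + by rewrite lee_fin -yE.
- move=> y; apply: measurable_funeM.
  by apply: emeasurable_funM; apply/measurable_EFinP.
- move=> y x _; rewrite muleCA; apply: mule_ge0; first by rewrite lee_fin.
  by rewrite -EFinM nnfun_muleindic_ge0.
Qed.

End density.

(** * Sections, monotonicity and comparison of densities *)

Section iterated_product_theory.
Context {R : realType}.
Implicit Types m : {sigma_finite_measure set (measurableTypeR R) -> \bar R}.

Lemma measurable_section n (A : set (n.+1.-tuple R)) a :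
  measurable A -> measurable [set t : n.-tuple R | A (tuple_cons a t)].
Proof.
move=> mA; rewrite -[X in measurable X]setTI.
have : measurable_fun setT (@tuple_cons R n a).
  by apply: (@measurable_cons _ _ (n.-tuple R) R (cst a) n id).
by move/(_ measurableT A mA).
Qed.

Lemma measurable_iterated_product_section m n (A : set (n.+1.-tuple R)) :
  measurable A ->
  measurable_fun setT (fun a : measurableTypeR R =>
    iterated_product m [set t | A (tuple_cons a t)]).
Proof.
move=> mA; have [mu ->] := iterated_product_measure m n.
have := @measurable_fun_xsection _ _ (measurableTypeR R) (n.-tuple R) R mu
  ((fun p : measurableTypeR R * n.-tuple R => tuple_cons p.1 p.2) @^-1` A).
rewrite (_ : _ \o _ = (fun a : measurableTypeR R =>
    mu [set t | A (tuple_cons a t)])).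
  by apply; rewrite -[X in measurable X]setTI; exact: measurable_cons_pair.
apply/funext => a /=; congr (mu _).
by apply/seteqP; split => t; rewrite /xsection/= inE.
Qed.

Lemma iterated_product_ge0 m n (A : set (n.-tuple R)) :
  (0 <= iterated_product m A)%E.
Proof. by have [mu ->] := iterated_product_measure m n. Qed.

(** The induction compares the integrals of the sections by [nnintegral_le], which keeps arbitrary
    sets admissible; [B] will be a Minkowski sum. *)
Lemma subset_iterated_product m n (A B : set (n.-tuple R)) :
  A `<=` B -> (iterated_product m A <= iterated_product m B)%E.
Proof.
elim: n A B => [|n IH] A B AB.
  rewrite /= !diracE; have [At|] := boolP (_ \in A); last by rewrite lee_fin.
  by rewrite mem_set//; apply: AB; rewrite inE in At.
rewrite !iterated_productS; apply: nnintegral_le => a.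
  exact: iterated_product_ge0.
by apply: IH => t; exact: AB.
Qed.

(* The sections of A over a satisfy the hypothesis with constant
   c g(a) / f(a), so the densities are compared one coordinate at a time. *)
Lemma iterated_product_density_le
    (m1 m2 : {sigma_finite_measure set (measurableTypeR R) -> \bar R})
    (mu : {measure set (measurableTypeR R) -> \bar R}) (f g : R -> R) :
  measurable_fun setT (f : measurableTypeR R -> R) ->
  measurable_fun setT (g : measurableTypeR R -> R) ->
  (forall x, 0 < f x) -> (forall x, 0 <= g x) ->
  (forall A, measurable A -> m1 A = \int[mu]_(x in A) (f x)%:E)%E ->
  (forall A, measurable A -> m2 A = \int[mu]_(x in A) (g x)%:E)%E ->
  forall n (A : set (n.-tuple R)) (c : R), measurable A -> 0 <= c ->
  (forall z, A z ->
    \prod_(i < n) f (tnth z i) <= c * \prod_(i < n) g (tnth z i)) ->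
  (iterated_product m1 A <= c%:E * iterated_product m2 A)%E.
Proof.
move=> mf mg f0 g0 m1E m2E; elim=> [|n IH] A c mA c0 Ac.
  (* In dimension 0 both products are empty, and the hypothesis at the empty tuple reads
     [1 <= c]. *)
  rewrite /= !diracE; have [At|] := boolP (_ \in A); last by rewrite mule0.
  rewrite inE in At; have := Ac _ At.
  by rewrite !big_ord0 mule1 lee_fin mulr1.
have f0' x : 0 <= f x by exact: ltW.
rewrite !iterated_productS.
(* Both outer integrals are rewritten against the common reference measure [mu], so that it remains
   to compare integrands at each [a]. *)
rewrite (ge0_integral_density mf f0' m1E)//; first last.
- by move=> x; exact: iterated_product_ge0.
- exact: measurable_iterated_product_section.
rewrite (ge0_integral_density mg g0 m2E)//; first last.
- by move=> x; exact: iterated_product_ge0.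
- exact: measurable_iterated_product_section.
rewrite -ge0_integralZl//; first last.
- by move=> x _; rewrite mule_ge0 ?lee_fin// iterated_product_ge0.
- apply: emeasurable_funM; first exact/measurable_EFinP.
  exact: measurable_iterated_product_section.
apply: nnintegral_le => a.
  by rewrite mule_ge0 ?lee_fin// iterated_product_ge0.
have cga : 0 <= c * g a / f a by rewrite mulr_ge0 ?invr_ge0// mulr_ge0.
set Aa := [set t | A (tuple_cons a t)].
have := IH Aa (c * g a / f a) (measurable_section a mA) cga.
have H z : Aa z ->
   \prod_(i < n) f (tnth z i) <= c * g a / f a * \prod_(i < n) g (tnth z i).
  move=> /Ac; rewrite !big_ord_recl !tnth0.
  under eq_bigr do rewrite tnthS.
  under [in X in _ <= X -> _]eq_bigr do rewrite tnthS.
  by rewrite mulrAC ler_pdivlMr// [_ * f a]mulrC -mulrA.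
move=> /(_ H) le1.
apply: (@le_trans _ _
  ((f a)%:E * ((c * g a / f a)%:E * iterated_product m2 Aa)))%E.
  by rewrite lee_wpmul2l// lee_fin.
by rewrite !muleA -!EFinM mulrC divfK// gt_eqF.
Qed.

End iterated_product_theory.

(** * Rectangles as a generating family *)

Section rectangles.
Context {R : realType}.

(** The sides are indexed by [nat] rather than ['I_n]: the induction on [n] then only shifts the
    index, and [mutually_independent] takes families of the same type. *)
Definition rectangle n (B : nat -> set R) : set (n.-tuple R) :=
  [set t | forall i : 'I_n, B i (tnth t i)].

Lemma measurable_rectangle n (B : nat -> set R) :
  (forall j, measurable (B j)) -> measurable (@rectangle n B).
Proof.
move=> mB.
have -> : @rectangle n B =
    \bigcap_(i in [set: 'I_n]) ((@tnth n R ^~ i) @^-1` B i).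
  by apply/seteqP; split => t tB i => [_|]; exact: tB.
apply: fin_bigcap_measurable => // i _.
by rewrite -[X in measurable X]setTI; exact: measurable_tnth.
Qed.

(** A generating cylinder over one coordinate is the rectangle whose other sides are [setT]. Unlike
    the cylinders, rectangles are closed under intersection, as uniqueness of measures requires. *)
Lemma tuple_measurable_rectangles n :
  @measurable _ (n.-tuple R) =
  <<s [set @rectangle n B | B in [set B | forall j, measurable (B j)]] >>.
Proof.
apply/seteqP; split; apply: smallest_sub.
- exact: smallest_sigma_algebra.
- move=> A; rewrite -bigcup_seq => -[i _ [B mB <-]].
  apply: sub_sigma_algebra.
  exists (fun j : nat => if j == i :> nat then B else setT) => /=.
    by move=> j; case: ifP.
  rewrite setTI; apply/seteqP; split => t /=.
    by move/(_ i); rewrite eqxx.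
  by move=> Bt j; case: ifPn => // /eqP/val_inj ->.
- exact: sigma_algebra_measurable.
- by move=> _ [B mB <-]; exact: measurable_rectangle.
Qed.

(** The section over [a] is the rectangle of the remaining sides if [a] lies in [B 0] and is empty
    otherwise, so the integrand is an indicator times a constant. *)
Lemma iterated_product_rectangle
    (m : {sigma_finite_measure set (measurableTypeR R) -> \bar R})
    n (B : nat -> set R) : (forall j, measurable (B j)) ->
  iterated_product m (@rectangle n B) = (\prod_(i < n) m (B i))%E.
Proof.
elim: n B => [|n IH] B mB.
  by rewrite big_ord0 /= diracE mem_set// => -[].
rewrite iterated_productS big_ord_recl.
have -> : (fun a => iterated_product m
     [set t | @rectangle n.+1 B (tuple_cons a t)]) =
   (fun a => (\1_(B 0%N) a)%:E * \prod_(i < n) m (B i.+1))%E.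
  apply/funext => a; rewrite indicE; have [Ba|nBa] := boolP (a \in B 0%N).
    rewrite mul1e -(IH (fun j => B j.+1))//; congr iterated_product.
    apply/seteqP; split => t /= tB i.
      by have := tB (lift ord0 i); rewrite tnthS.
    have [j ->|->] := unliftP ord0 i; first by rewrite tnthS; exact: tB.
    by rewrite tnth0; rewrite inE in Ba.
  rewrite mul0e (_ : [set _ | _] = set0).
    by have [mu ->] := iterated_product_measure m n; rewrite measure0.
  apply/seteqP; split => t //= /(_ ord0); rewrite tnth0 => Ba.
  by rewrite mem_set in nBa.
rewrite ge0_integralZr//.
- congr (_ * _)%E; rewrite integral_indic//; last exact: mB.
  by congr (m _); exact: setIT.
- by apply/measurable_EFinP; apply: measurable_indic; exact: mB.
- by apply: prode_ge0.
Qed.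

End rectangles.

(** * The law of the noise vector *)

Section noise_law.
Context {d : measure_display} {Omega : measurableType d} {R : realType}
  {P : probability Omega R}.

Lemma measurable_noise_vector (Z : nat -> {RV P >-> R}) n :
  measurable_fun setT (noise_vector Z n).
Proof.
apply/measurable_fun_tnthP => i.
rewrite (_ : _ \o _ = Z i) //.
by apply/funext => w /=; rewrite tnth_mktuple.
Qed.

(** Independence makes the two measures agree on rectangles, a generating family closed under
    intersection; the law of the noise vector is finite, so they agree on all measurable sets. *)
Lemma noise_vector_law (Z : nat -> {RV P >-> R})
    (m : {sigma_finite_measure set (measurableTypeR R) -> \bar R})
    n (A : set (n.-tuple R)) :
  mutually_independent Z ->
  (forall i B, measurable B -> distribution P (Z i) B = m B) ->
  measurable A ->
  P (noise_vector Z n @^-1` A) = iterated_product m A.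
Proof.
move=> indZ ZE mA; have [mu muE] := iterated_product_measure m n.
pose law : {measure set (n.-tuple R) -> \bar R} :=
  measure_function_pushforward__canonical__measure_function_Measure P
    (@measurable_noise_vector Z n).
pose G := [set @rectangle R n B | B in [set B | forall j, measurable (B j)]].
rewrite muE; apply: (measure_unique G (fun=> setT) _ _ _ _ law mu) => //.
- exact: tuple_measurable_rectangles.
- move=> _ _ [B mB <-] [C mC <-]; exists (fun j => B j `&` C j).
    by move=> j; exact: measurableI.
  apply/seteqP; split => t /=.
    by move=> BC; split => i; case: (BC i).
  by move=> [Bt Ct] i; split; [exact: Bt|exact: Ct].
- by move=> _; exists (fun=> setT) => //; apply/seteqP.
- exact: bigcup_const.
- move=> _ [B mB <-].
  transitivity (iterated_product m (@rectangle R n B)); last by rewrite muE.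
  rewrite iterated_product_rectangle//.
  rewrite /= /pushforward.
  (* The event is put into the form of [mutually_independent], with the finite index set 0, ..., n -
     1. *)
  have -> : noise_vector Z n @^-1` @rectangle R n B =
      \bigcap_(j in [set` [fset j in iota 0 n]%fset]) (Z j @^-1` B j).
    apply/seteqP; split => w /= wB.
      move=> j /=; rewrite !inE mem_iota/= add0n => jn.
      by have := wB (Ordinal jn); rewrite tnth_mktuple.
    move=> i; rewrite tnth_mktuple; apply: wB => /=.
    by rewrite !inE mem_iota/= add0n.
  rewrite indZ// (perm_big (iota 0 n)) /=; last first.
    apply: uniq_perm; [exact: fset_uniq|exact: iota_uniq|].
    by move=> j; rewrite !inE.
  rewrite -[X in iota 0 X]subn0 -/(index_iota 0 n) big_mkord.
  by apply: eq_bigr => i _; exact: ZE.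
- by move=> _; rewrite /= /pushforward preimage_setT probability_setT ltry.
Qed.

End noise_law.

(** * Translation invariance of the volume *)

Section translation.
Context {R : realType}.
Local Notation mu := (@lebesgue_measure R).

Lemma measurable_addl (a : R) :
  measurable_fun setT
    ((fun x => a + x) : measurableTypeR R -> measurableTypeR R).
Proof.
by apply: (@measurable_funD _ (measurableTypeR R) R setT (cst a) id).
Qed.

(** The image of Lebesgue measure under a translation gives every half-open interval its length,
    which characterizes Lebesgue measure. *)
Lemma lebesgue_measure_addl (a : R) (A : set (measurableTypeR R)) :
  measurable A -> mu A = pushforward mu (fun x => a + x) A.
Proof.
pose nu : {measure set (measurableTypeR R) -> \bar R} :=
  measure_function_pushforward__canonical__measure_function_Measure mu
    (measurable_addl a).
apply: (@lebesgue_measure_unique R nu) => _ [[x y] _ <-].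
rewrite /= /pushforward (_ : _ @^-1` _ = `]x - a, y - a]%classic); last first.
  by apply/seteqP; split => z /=; rewrite !in_itv/= ltrBlDl lerBrDl.
rewrite !lebesgue_measure_itv/= !lte_fin ltrD2r.
by rewrite -!EFinB opprB addrA subrK.
Qed.

Lemma ge0_integral_addl (a : R) (h : measurableTypeR R -> \bar R) :
  measurable_fun setT h -> (forall x, (0 <= h x)%E) ->
  (\int[mu]_x h (a + x)%R = \int[mu]_x h x)%E.
Proof.
move=> mh h0.
rewrite [RHS](eq_measure_integral
  (measure_function_pushforward__canonical__measure_function_Measure mu
    (measurable_addl a))); last by move=> A mA _; exact: lebesgue_measure_addl.
by rewrite ge0_integral_pushforward//; exact: measurable_addl.
Qed.

Lemma measurable_tuple_add n (x : n.-tuple R) :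
  measurable_fun setT (tuple_add x).
Proof.
apply/measurable_fun_tnthP => i.
rewrite (_ : _ \o _ = fun z => tnth x i + tnth z i).
  by apply: measurable_funD => //; exact: measurable_tnth.
by apply/funext => w /=; rewrite tnth_mktuple.
Qed.

Lemma tuple_add_cons n (x : n.+1.-tuple R) a (t : n.-tuple R) :
  tuple_add x (tuple_cons a t) =
  tuple_cons (thead x + a) (tuple_add [tuple of behead x] t).
Proof.
apply: eq_from_tnth => i; rewrite tnth_mktuple.
have [j ->|->] := unliftP ord0 i.
  by rewrite !tnthS tnth_mktuple [in LHS](tuple_eta x) tnthS.
by rewrite !tnth0.
Qed.

(** The section over [a] of the translated set is the section of [A] over [thead x + a], translated
    by the tail of [x]. The tail is removed by induction, the head by a shift of the outer
    integral. *)
Lemma volume_tuple_add n (x : n.-tuple R) (A : set (n.-tuple R)) :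
  measurable A -> volume (tuple_add x @^-1` A) = volume A.
Proof.
rewrite volumeE; elim: n x A => [|n IH] x A mA.
  rewrite (_ : tuple_add x @^-1` A = A)//.
  by apply/seteqP; split => t /=; rewrite (tuple0 (tuple_add x t)) (tuple0 t).
rewrite !iterated_productS.
have h0 a : (0 <=
    iterated_product lebesgue_measure [set t | A (tuple_cons a t)])%E.
  exact: iterated_product_ge0.
rewrite -[RHS](ge0_integral_addl (thead x)
  (measurable_iterated_product_section lebesgue_measure mA) h0).
congr (integral _ _ _); apply/funext => a /=.
rewrite -[RHS](IH [tuple of behead x]); last first.
  exact: (measurable_section (thead x + a) mA).
by congr iterated_product; apply/seteqP; split => t /=; rewrite tuple_add_cons.
Qed.

End translation.

(** * Gaussian densities, tails and comparison with volume *)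

Section gaussian.
Context {R : realType}.
Implicit Types nu t : R.

Definition norm_sqr n (z : n.-tuple R) : R := \sum_(i < n) tnth z i ^+ 2.

Lemma measurable_norm_sqr n : measurable_fun setT (@norm_sqr n).
Proof.
apply: measurable_sum => i; apply: measurable_funX.
exact: measurable_tnth.
Qed.

Definition gaussian nu n : set (n.-tuple R) -> \bar R :=
  iterated_product (normal_prob 0 (Num.sqrt nu)) (n:=n).
Arguments gaussian : clear implicits.

Definition gaussian_pdf nu (x : R) := normal_pdf 0 (Num.sqrt nu) x.

Lemma gaussian_pdfE nu x : 0 < nu -> gaussian_pdf nu x =
  expR (- (2^-1 * ln (2 * pi * nu)) - x ^+ 2 / (2 * nu)).
Proof.
move=> nu0; rewrite /gaussian_pdf normal_pdfE; last first.
  by rewrite gt_eqF// sqrtr_gt0.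
rewrite /normal_peak /normal_fun subr0 sqr_sqrtr ?ltW// expRD.
have p0 : 0 < 2 * pi * nu by rewrite !mulr_gt0// pi_gt0.
congr (_ * _).
  rewrite expRN (_ : nu * pi *+ 2 = 2 * pi * nu); last first.
    by rewrite -mulr_natl; ring.
  by rewrite -powR12_sqrt ?ltW// /powR gt_eqF.
by congr expR; rewrite mulNr -mulr_natl.
Qed.

(** The joint density depends on [z] only through [norm_sqr z], so bounds on the squared norm turn
    into bounds on the density. *)
Lemma prod_gaussian_pdf nu n (z : n.-tuple R) : 0 < nu ->
  \prod_(i < n) gaussian_pdf nu (tnth z i) =
  expR (- (n%:R / 2 * ln (2 * pi * nu)) - norm_sqr z / (2 * nu)).
Proof.
move=> nu0; under eq_bigr do rewrite gaussian_pdfE//.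
rewrite -expR_sum big_split/= sumr_const card_ord -[_ *+ n]mulr_natl.
rewrite sumrN -mulr_suml; congr (expR (_ - _)).
by rewrite mulrN mulrA.
Qed.

Let mgauss nu : measurable_fun setT (gaussian_pdf nu : measurableTypeR R -> R).
Proof. exact: measurable_normal_pdf. Qed.

Let gauss_gt0 nu x : 0 < nu -> 0 < gaussian_pdf nu x.
Proof. by move=> nu0; rewrite gaussian_pdfE// expR_gt0. Qed.

Lemma gaussian_le1 nu n (A : set (n.-tuple R)) : (gaussian nu n A <= 1)%E.
Proof.
apply: (@le_trans _ _ (gaussian nu n (@rectangle R n (fun=> setT)))).
  by apply: subset_iterated_product => t _ i.
rewrite /gaussian iterated_product_rectangle// big1// => i _.
exact: probability_setT.
Qed.

(* Chernoff bound as a change of variance: on A the density of variance nu is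
   at most the exponential factor times the density of variance nu * t. *)
Lemma gaussian_tail nu t n (A : set (n.-tuple R)) : 0 < nu -> 0 < t ->
  measurable A ->
  (forall z, A z -> n%:R * nu * t * (t - 1) <= norm_sqr z * (t - 1)) ->
  (gaussian nu n A <= (expR (- (n%:R / 2 * (t - 1 - ln t))))%:E)%E.
Proof.
move=> nu0 t0 mA HA.
have nut0 : 0 < nu * t by rewrite mulr_gt0.
apply: (@le_trans _ _ ((expR (- (n%:R / 2 * (t - 1 - ln t))))%:E *
    gaussian (nu * t) n A)%E); last first.
  by rewrite -[leRHS]mule1 lee_wpmul2l ?lee_fin ?expR_ge0// gaussian_le1.
apply: (@iterated_product_density_le R _ _ lebesgue_measure
   (gaussian_pdf nu) (gaussian_pdf (nu * t))) => //.
- by move=> x; exact: gauss_gt0.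
- by move=> x; exact/ltW/gauss_gt0.
- move=> z /HA le1; rewrite !prod_gaussian_pdf// -expRD ler_expR.
  rewrite [2 * pi * (nu * t)]mulrA [ln (2 * pi * nu * t)]lnM ?posrE//;
    last by rewrite !mulr_gt0 ?pi_gt0.
  (* This is what remains after taking logarithms and cancelling the normalizing terms. The factor
     [t - 1] in [HA] carries the sign, so the upper tail ([t > 1]) and the lower tail ([t < 1])
     share one computation. *)
  suff: n%:R / 2 * (t - 1) <=
      norm_sqr z / (2 * nu) - norm_sqr z / (2 * (nu * t)).
    by lra.
  have -> : norm_sqr z / (2 * nu) - norm_sqr z / (2 * (nu * t)) =
     (norm_sqr z * (t - 1)) / (2 * nu * t).
    by field; rewrite !gt_eqF.
  rewrite ler_pdivlMr ?mulr_gt0//; apply: le_trans le1.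
  by rewrite le_eqVlt; apply/orP; left; apply/eqP; field.
Qed.

(** Lebesgue measure is taken as the iterated product with density 1. The squared norm contributes
    at most exp(-n/2 + n delta / (2 nu)) to the Gaussian density, and the term n/2 is what turns
    ln(2 pi nu) into ln(2 pi e nu). *)
Lemma gaussian_le_volume nu delta n (A : set (n.-tuple R)) : 0 < nu ->
  measurable A -> (forall z, A z -> n%:R * (nu - delta) <= norm_sqr z) ->
  (gaussian nu n A <=
   (expR (- (n%:R *
       (2^-1 * ln (2 * pi * expR 1 * nu) - delta / (2 * nu)))))%:E *
   volume A)%E.
Proof.
move=> nu0 mA HA; rewrite volumeE.
apply: (@iterated_product_density_le R _ _ lebesgue_measure
   (gaussian_pdf nu) (cst 1)) => //.
- by move=> x; exact: gauss_gt0.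
- by move=> B mB; have := integral_cst lebesgue_measure mB 1%E; rewrite mul1e.
- move=> z /HA le1; rewrite [X in _ * X]big1 ?mulr1//.
  rewrite prod_gaussian_pdf// ler_expR.
  rewrite (_ : 2 * pi * expR 1 * nu = (2 * pi * nu) * expR 1); last by ring.
  rewrite [ln (2 * pi * nu * _)]lnM ?posrE ?expR_gt0 ?mulr_gt0 ?pi_gt0// expRK.
  suff: n%:R / 2 - n%:R * delta / (2 * nu) <= norm_sqr z / (2 * nu) by lra.
  rewrite ler_pdivlMr ?mulr_gt0//; apply: le_trans le1.
  by rewrite le_eqVlt; apply/orP; left; apply/eqP; field; rewrite gt_eqF.
Qed.

End gaussian.
Arguments gaussian {R} nu n _.

(** * Packing the typical decoding regions *)

Section packing.
Context {d : measure_display} {Omega : measurableType d} {R : realType}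
  {P : probability Omega R}.
Variables (sigma rho nu : R) (Z : nat -> {RV P >-> R}).
Hypotheses (nu0 : 0 < nu) (HZ : awgn_noise nu Z).
Local Notation PP := (P : set Omega -> \bar R).

Lemma gaussian_noise n (A : set (n.-tuple R)) : measurable A ->
  PP (noise_vector Z n @^-1` A) = gaussian nu n A.
Proof.
move=> mA; case: HZ => indZ ZE.
exact: (@noise_vector_law _ _ _ P Z (normal_prob 0 (Num.sqrt nu)) n A).
Qed.

Variables (n M : nat) (c : Defs.code sigma rho n M) (delta : R).
Hypothesis delta0 : 0 < delta.

Definition shell : set (n.-tuple R) :=
  [set z | n%:R * (nu - delta) <= norm_sqr z <= n%:R * (nu + delta)].

Lemma measurable_shell : measurable shell.
Proof.
rewrite (_ : shell = @norm_sqr R n @^-1`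
    `[n%:R * (nu - delta), n%:R * (nu + delta)]%classic); last first.
  by apply/seteqP; split => z; rewrite /= in_itv.
by rewrite -[X in measurable X]setTI; apply: measurable_norm_sqr.
Qed.

Definition typical_region (m : 'I_M) : set (n.-tuple R) :=
  [set y | decoder c y = m /\
     shell (tuple_add [tuple - tnth (encoder c m) i | i < n] y)].

Lemma measurable_typical_region m : measurable (typical_region m).
Proof.
apply: measurableI; first exact: decoder_measurable.
rewrite -[X in measurable X]setTI; apply: measurable_tuple_add => //.
exact: measurable_shell.
Qed.

Lemma tuple_addKN (x z : n.-tuple R) :
  tuple_add [tuple - tnth x i | i < n] (tuple_add x z) = z.
Proof. by apply: eq_from_tnth => i; rewrite !tnth_mktuple addKr. Qed.

Lemma tuple_addNK (x z : n.-tuple R) :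
  tuple_add x (tuple_add [tuple - tnth x i | i < n] z) = z.
Proof. by apply: eq_from_tnth => i; rewrite !tnth_mktuple addNKr. Qed.

(** The regions are disjoint because [decoder] has one value at each point. Additivity is applied to
    their measurable union [U], and a point of [U] is a codeword plus a vector of the ball. *)
Lemma sum_volume_typical_region :
  (\sum_(m < M) volume (typical_region m) <=
   volume (minkowski_sum (power_constraint n sigma rho)
     (euclidean_ball n (Num.sqrt (n%:R * (nu + delta))))))%E.
Proof.
have [mu muE] := iterated_product_measure (@lebesgue_measure R) n.
rewrite volumeE.
pose U := \big[setU/set0]_(m < M) typical_region m.
have -> : (\sum_(m < M) iterated_product lebesgue_measure (typical_region m) =
   iterated_product lebesgue_measure U)%E.
  rewrite muE [RHS]measure_bigsetU_ord//.
    by move=> i; exact: measurable_typical_region.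
  by move=> i j _ _ [y [[<- _] [<- _]]].
apply: subset_iterated_product => y; rewrite /U -bigcup_seq.
move=> [m _ [_ /andP[_ zle]]].
exists (encoder c m); first exact: encoder_power.
exists (tuple_add [tuple - tnth (encoder c m) i | i < n] y).
  by rewrite /euclidean_ball /euclidean_norm /= ler_wsqrtr.
exact: tuple_addNK.
Qed.

Lemma measurable_error_event m : measurable (error_event Z c m).
Proof.
rewrite (_ : error_event Z c m = ~` (noise_vector Z n @^-1`
  (tuple_add (encoder c m) @^-1` (decoder c @^-1` [set m]))))//.
apply: measurableC; rewrite -[X in measurable X]setTI.
apply: measurable_noise_vector => //; rewrite -[X in measurable X]setTI.
apply: measurable_tuple_add => //; exact: decoder_measurable.
Qed.

(** The two sides of the shell are bounded by [gaussian_tail] with [t = 1 + delta / nu] and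
    [t = 1 - delta / nu], for which [nu * t] is the boundary value [nu + delta] or [nu - delta];
    [delta < nu] keeps the second [t] positive. *)
Lemma atypical_noise :
  delta < nu ->
  (PP (noise_vector Z n @^-1` (~` shell)) <=
   (expR (- (n%:R / 2 * (delta / nu - ln (1 + delta / nu)))) +
    expR (- (n%:R / 2 * (- (delta / nu) - ln (1 - delta / nu)))))%:E)%E.
Proof.
move=> dnu; have dnu0 : 0 < delta / nu by rewrite divr_gt0.
pose up := @norm_sqr R n @^-1` `]n%:R * (nu + delta), +oo[%classic.
pose down := @norm_sqr R n @^-1` `]-oo, n%:R * (nu - delta)[%classic.
have mup : measurable up.
  by rewrite -[X in measurable X]setTI; apply: measurable_norm_sqr.
have mdown : measurable down.
  by rewrite -[X in measurable X]setTI; apply: measurable_norm_sqr.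
rewrite gaussian_noise; last by apply: measurableC; exact: measurable_shell.
apply: (@le_trans _ _ (gaussian nu n (up `|` down))).
  apply: subset_iterated_product => z /negP.
  rewrite negb_and -!ltNge => /orP[zd|zu].
    by right; rewrite /down/= in_itv.
  by left; rewrite /up/= in_itv/= zu.
apply: (@le_trans _ _ (gaussian nu n up + gaussian nu n down)%E).
  rewrite /gaussian; have [mu ->] :=
    iterated_product_measure (normal_prob 0 (Num.sqrt nu)) n.
  by apply: measureU2.
rewrite EFinD; apply: leeD.
  rewrite (_ : delta / nu - _ = (1 + delta / nu) - 1 - ln (1 + delta / nu));
    last by ring.
  apply: gaussian_tail => //; first by rewrite addr_gt0.
  move=> z; rewrite /up /= in_itv/= andbT => /ltW zu.
  rewrite addrAC subrr add0r ler_wpM2r ?(ltW dnu0)//.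
  by rewrite (_ : _ * _ = n%:R * (nu + delta))//; field; rewrite gt_eqF.
rewrite (_ : - (delta / nu) - _ = (1 - delta / nu) - 1 - ln (1 - delta / nu));
  last by ring.
apply: gaussian_tail => //; first by rewrite subr_gt0 ltr_pdivrMr// mul1r.
move=> z; rewrite /down /= in_itv/= => /ltW zd.
rewrite addrAC subrr add0r !mulrN lerN2 ler_wpM2r ?(ltW dnu0)//.
rewrite [leRHS](_ : _ = n%:R * (nu - delta))//; field.
by rewrite gt_eqF.
Qed.

(** Union bound: the message is decoded wrongly, or the noise leaves the shell, or the noise lies in
    the typical region shifted back to the origin. The shift preserves volume, so
    [gaussian_le_volume] bounds the third probability. *)
Lemma correct_noise m :
  (1 <= PP (error_event Z c m) +
    (PP (noise_vector Z n @^-1` (~` shell)) +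
     (expR (- (n%:R *
       (2^-1 * ln (2 * pi * expR 1 * nu) - delta / (2 * nu)))))%:E *
     volume (typical_region m)))%E.
Proof.
pose A := tuple_add (encoder c m) @^-1` typical_region m.
have mA : measurable A.
  rewrite -[X in measurable X]setTI; apply: measurable_tuple_add => //.
  exact: measurable_typical_region.
have mpre B : measurable B -> measurable (noise_vector Z n @^-1` B).
  move=> mB; rewrite -[X in measurable X]setTI.
  exact: measurable_noise_vector.
have mS : measurable (noise_vector Z n @^-1` (~` shell)).
  by apply: mpre; apply: measurableC; exact: measurable_shell.
have mE := measurable_error_event m.
apply: (@le_trans _ _ (PP (error_event Z c m) +
   (PP (noise_vector Z n @^-1` (~` shell)) + PP (noise_vector Z n @^-1` A)))%E).
  apply: (@le_trans _ _ (PP (error_event Z c m `|`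
     (noise_vector Z n @^-1` (~` shell) `|` noise_vector Z n @^-1` A)))).
    rewrite -(@probability_setT _ _ _ P); apply: le_measure; rewrite ?inE//.
      by apply: measurableU => //; apply: measurableU => //; exact: mpre.
    move=> w _; have [Tw|] := pselect (shell (noise_vector Z n w));
      last by right; left.
    have [dw|] := pselect
        (decoder c (tuple_add (encoder c m) (noise_vector Z n w)) = m).
      by right; right; split => //; rewrite tuple_addKN.
    by left.
  apply: (le_trans (measureU2 _ _ _)) => //.
    by apply: measurableU => //; exact: mpre.
  by rewrite leeD2l//; apply: measureU2 => //; exact: mpre.
rewrite !leeD2l// gaussian_noise//.
rewrite -(volume_tuple_add (encoder c m)); last first.
  exact: measurable_typical_region.
apply: gaussian_le_volume => // z [_].
by rewrite tuple_addKN => /andP[].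
Qed.

(** Summing [correct_noise] over the messages, errors and atypical noise each account for at most
    [M * eta] of the total [M]; the volumes must make up the rest. *)
Lemma packing_bound (eta : R) :
  (PP (noise_vector Z n @^-1` (~` shell)) <= eta%:E)%E ->
  (error_probability Z c <= eta%:E)%E ->
  ((M%:R * (1 - 2 * eta))%:E <=
   (expR (- (n%:R *
       (2^-1 * ln (2 * pi * expR 1 * nu) - delta / (2 * nu)))))%:E *
   volume (minkowski_sum (power_constraint n sigma rho)
     (euclidean_ball n (Num.sqrt (n%:R * (nu + delta))))))%E.
Proof.
set K := expR _; set V := volume _ => tail err.
(* For [M = 0] the inverse in [error_probability] is 0 by convention, so [err] says nothing and the
   bound is checked directly. *)
have [M0|M0] := posnP M.
  rewrite M0 mul0r mule_ge0 ?lee_fin ?expR_ge0// /V volumeE.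
  exact: iterated_product_ge0.
have M0' : 0 < M%:R :> R by rewrite ltr0n.
have err' : (\sum_(m < M) PP (error_event Z c m) <= (M%:R * eta)%:E)%E.
  by move: err; rewrite /error_probability lee_pdivrMl.
have : (\sum_(m < M) 1%E <= \sum_(m < M) (PP (error_event Z c m) +
   (eta%:E + K%:E * volume (typical_region m))))%E.
  apply: lee_sum => m _; apply: (le_trans (correct_noise m)).
  by rewrite leeD2l// leeD2r.
have sumc (r : R) : (\sum_(m < M) r%:E = (M%:R * r)%:E)%E.
  by rewrite sumEFin sumr_const card_ord mulr_natl.
rewrite big_split/= big_split/= (sumc 1) (sumc eta) mulr1.
move=> le1.
have le2 : (M%:R%:E <= (M%:R * eta)%:E + ((M%:R * eta)%:E + K%:E * V))%E.
  apply: (le_trans le1); rewrite leeD// leeD2l//.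
  rewrite -ge0_sume_distrr; last first.
    by move=> m _; rewrite volumeE iterated_product_ge0.
  by rewrite lee_wpmul2l ?lee_fin ?expR_ge0//; exact: sum_volume_typical_region.
(* Only finite terms are moved across, so the step remains valid when [V] is infinite. *)
rewrite addeA -leeBlDl// in le2.
apply: le_trans le2; rewrite -EFinD lee_fin; lra.
Qed.

End packing.

(** * Upper limits and elementary estimates *)

Section limits.
Context {R : realType}.

Lemma le_limn_esup (u v : (\bar R)^nat) :
  (forall n, (u n <= v n)%E) -> (limn_esup u <= limn_esup v)%E.
Proof.
move=> uv; rewrite !limn_esup_lim.
apply: lee_lim; [exact: is_cvg_esups|exact: is_cvg_esups|].
apply: nearW => n; apply: ge_ereal_sup => _ [k nk <-].
by apply: (le_trans (uv k)); apply: ereal_sup_ubound; exists k.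
Qed.

Lemma limn_esup_ge_near (u : (\bar R)^nat) (l : \bar R) :
  (\forall n \near \oo, (l <= u n)%E) -> (l <= limn_esup u)%E.
Proof.
move=> lu; rewrite limn_esup_lim; apply: lime_ge; first exact: is_cvg_esups.
near=> n; have ln : (l <= u n)%E by near: n.
by apply: (le_trans ln); apply: ereal_sup_ubound; exists n => /=.
Unshelve. all: by end_near. Qed.

(** The balls grow with [eps]. This monotonicity yields the existence of the limit as [eps] tends to
    0 from the right. *)
Lemma nondecreasing_volume_exponent (sigma rho nu e1 e2 : R) :
  e1 <= e2 ->
  (volume_exponent sigma rho nu e1 <= volume_exponent sigma rho nu e2)%E.
Proof.
move=> e12; apply: le_limn_esup => n.
apply: lee_wpmul2l; first by rewrite lee_fin invr_ge0.
have vol0 (A : set (n.-tuple R)) : volume A \in `[0%E, +oo%E].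
  by rewrite in_itv/= leey andbT volumeE iterated_product_ge0.
rewrite lee_lne// volumeE; apply: subset_iterated_product.
move=> _ [x Sx [z zB <-]]; exists x => //; exists z => //.
by apply: (le_trans zB); rewrite ler_wsqrtr// ler_wpM2l// lerD2l.
Qed.

(** At [x = delta / nu] and [x = - (delta / nu)], strictness makes both exponents of
    [atypical_noise] positive. *)
Lemma ln1Dx_lt (x : R) : -1 < x -> x != 0 -> ln (1 + x) < x.
Proof.
move=> x1 x0; rewrite -ltr_expR lnK ?expR_gt1Dx//.
by rewrite posrE -ltrBlDl sub0r.
Qed.

(** Rounding the number of messages down to an integer costs at most a factor 2. *)
Lemma truncn_ge_half (x : R) :
  (0 < Num.truncn x)%N -> x <= 2 * (Num.truncn x)%:R.
Proof.
move=> x0; have := truncnS_gt x; rewrite -natr1.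
have : 1 <= (Num.truncn x)%:R :> R by rewrite ler1n.
lra.
Qed.

Lemma near_expRN_le (a b : R) : 0 < a -> 0 < b ->
  \forall n \near \oo, expR (- (n%:R / 2 * a)) <= b.
Proof.
move=> a0 b0; near=> n.
rewrite -[leRHS]lnK ?posrE// ler_expR lerNl.
have : - ln b * 2 / a <= n%:R by near: n; exact: nbhs_infty_ger.
by rewrite ler_pdivrMr//; lra.
Unshelve. all: by end_near. Qed.

Lemma near_le_cvg0 (u : (\bar R)^nat) (b : R) : 0 < b -> u @ \oo --> 0%E ->
  \forall n \near \oo, (u n <= b%:E)%E.
Proof.
move=> b0 /fine_cvgP[ufin /cvgr0_norm_le /(_ b b0) ub].
near=> n; have un : u n \is a fin_num by near: n.
rewrite -(fineK un) lee_fin; apply: (le_trans (ler_norm _)).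
by near: n.
Unshelve. all: by end_near. Qed.

End limits.

(** * From the packing bound to the rate *)

Section converse.
Context {d : measure_display} {Omega : measurableType d} {R : realType}
  {P : probability Omega R}.
Variables (sigma rho nu : R) (Z : nat -> {RV P >-> R}).
Hypotheses (nu0 : 0 < nu) (HZ : awgn_noise nu Z).

Lemma rate_le_volume_exponent (rate delta : R) : achievable Z sigma rho rate ->
  0 < delta -> delta < nu ->
  ((rate + (2^-1 * ln (2 * pi * expR 1 * nu) - delta / (2 * nu)))%:E <=
   volume_exponent sigma rho nu delta)%E.
Proof.
move=> [c cvgc] delta0 dnu; set L := 2^-1 * _ - _.
have dnu0 : 0 < delta / nu by rewrite divr_gt0.
have dnu1 : delta / nu < 1 by rewrite ltr_pdivrMr// mul1r.
(* The slack [e] will absorb [ln 4 / n], the price of the constant factors lost below. *)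
apply/lee_addgt0Pr => e e0; rewrite -leeBlDr// -EFinB.
apply: limn_esup_ge_near; near=> n.
have n0 : 0 < n%:R :> R.
  by apply: (@lt_le_trans _ _ 1) => //; near: n; exact: nbhs_infty_ger.
set M := Num.truncn (expR (n%:R * rate)).
(* No sign of [rate] is known here, but the decoder has a value in ['I_M], so there is at least one
   message. *)
have M0 : (0 < M)%N.
  exact: leq_ltn_trans (leq0n _) (ltn_ord (decoder (c n) [tuple 0 | i < n])).
have tail : (P (noise_vector Z n @^-1` (~` shell nu delta)) <= (4^-1)%:E)%E.
  apply: (le_trans (atypical_noise nu0 HZ n delta0 dnu)); rewrite lee_fin.
  (* Each of the two tails is eventually at most 1/8. *)
  rewrite (_ : 4^-1 = 8^-1 + 8^-1); last by field.
  apply: lerD; near: n; apply: near_expRN_le => //.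
    by rewrite subr_gt0 ln1Dx_lt ?gt_eqF// (lt_trans _ dnu0)// ltrN10.
  by rewrite subr_gt0 ln1Dx_lt ?lt_eqF ?oppr_lt0// ltrN2.
have err : (error_probability Z (c n) <= (4^-1)%:E)%E.
  by near: n; apply: near_le_cvg0 cvgc; rewrite invr_gt0.
have := packing_bound nu0 HZ tail err.
rewrite -/L; set V := volume _ => HV.
(* The 4 collects a factor 2 from [1 - 2 * eta] at [eta = 1/4] and a factor 2 from truncating
   [expR (n%:R * rate)] to [M]. *)
have HV1 : ((expR (n%:R * (rate + L) - ln 4))%:E <= V)%E.
  have HV2 : ((expR (n%:R * L) * (M%:R * (1 - 2 * 4^-1)))%:E <= V)%E.
    have := lee_wpmul2l (_ : 0 <= (expR (n%:R * L))%:E)%E HV.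
    rewrite muleA -!EFinM -expRD subrr expR0 mul1e; apply.
    by rewrite lee_fin expR_ge0.
  apply: le_trans HV2; rewrite lee_fin.
  rewrite expRB lnK ?posrE// mulrDr expRD [expR (_ * rate) * _]mulrC -mulrA.
  rewrite ler_wpM2l ?expR_ge0//; have := truncn_ge_half M0; rewrite -/M; lra.
have : ((n%:R * (rate + L) - ln 4)%:E <= lne V)%E.
  have -> : (n%:R * (rate + L) - ln 4)%:E =
     lne (expR (n%:R * (rate + L) - ln 4))%:E :> \bar R.
    by rewrite lne_EFin ?expR_gt0// expRK.
  rewrite lee_lne// in_itv/= leey andbT ?lee_fin ?expR_ge0//.
  by apply: le_trans HV1; rewrite lee_fin expR_ge0.
move=> HV3.
have := lee_wpmul2l (_ : 0 <= (n%:R^-1)%:E)%E HV3.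
move=> /(_ _)/(le_trans _); apply; last by rewrite lee_fin invr_ge0.
rewrite -EFinM lee_fin mulrBr mulKf ?gt_eqF// lerD2l lerN2.
rewrite mulrC ler_pdivrMr// mulrC -ler_pdivrMr//.
by near: n; exact: nbhs_infty_ger.
Unshelve. all: by end_near. Qed.

End converse.

Theorem theorem6p1 (R : realType) (sigma rho nu : R)
    (d : measure_display) (Omega : measurableType d) (P : probability Omega R)
    (Z : nat -> {RV P >-> R}) :
  0 <= sigma -> 0 <= rho -> 0 < nu -> awgn_noise nu Z ->
  cvg (volume_exponent sigma rho nu eps @[eps --> 0^'+]) /\
  (capacity Z sigma rho <=
     lim (volume_exponent sigma rho nu eps @[eps --> 0^'+]) -
     (2^-1 * ln (2 * pi * expR 1 * nu))%:E)%E.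
Proof.
move=> _ _ nu0 HZ.
(* A monotone function with values in the extended reals has a one-sided limit, so [lim] below is a
   genuine limit. *)
have cvgE : cvg (volume_exponent sigma rho nu eps @[eps --> 0^'+]).
  apply: nondecreasing_at_right_is_cvge; apply: nearW => a x y _ _ xy.
  exact: nondecreasing_volume_exponent.
split=> //; apply: ge_ereal_sup => _ [rate Hrate <-].
rewrite leeBrDr// -EFinD; apply/lee_addgt0Pr => e e0; rewrite -leeBlDr// -EFinB.
(* It suffices to bound the exponent for all small [delta]: below [nu] for the tail estimate, and
   below [e * (2 * nu)] so that the loss [delta / (2 * nu)] is at most [e]. *)
apply: lime_ge => //; near=> delta.
have delta0 : 0 < delta by near: delta; exact: nbhs_right_gt.
have dnu : delta < nu by near: delta; exact: nbhs_right_lt.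
apply: le_trans (rate_le_volume_exponent nu0 HZ Hrate delta0 dnu).
rewrite lee_fin addrA lerD2l lerN2 ler_pdivrMr ?mulr_gt0//.
apply: ltW; near: delta; apply: nbhs_right_lt.
by rewrite !mulr_gt0.
Unshelve. all: by end_near. Qed.
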